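(* Let $G$ be a twin-free weighted graph, let $\phi,\psi\in V(G)^k$ (viewed as maps $\{1,\dots,k\}\to V(G)$), and suppose that $\hom_\phi(F,G)=\hom_\psi(F,G)$ for every $k$-labeled graph $F$. Then there exists an automorphism $\sigma$ of $G$ such that $\psi=\phi\sigma$, i.e. $\psi(i)=\sigma(\phi(i))$ for all $i\in\{1,\dots,k\}$.
   Context: A weighted graph $G$ consists of a finite node set $V(G)$, a positive real weight $\alpha_G(i)$ for each node $i$, and a real weight $\beta_{ij}=\beta_G(i,j)=\beta_G(j,i)$ for each pair of nodes $i,j$ (including loops $i=j$; a missing edge is the same as an edge of weight $0$). Two nodes $i,j\in V(G)$ are twins if $\beta_{il}=\beta_{jl}$ for every $l\in V(G)$ (including $l=i$ and $l=j$; node weights play no role). $G$ is twin-free if no two different nodes are twins. An automorphism of $G$ is a permutation $\sigma$ of $V(G)$ preserving node weights and edge weights: $\alpha_G(\sigma(i))=\alpha_G(i)$ and $\beta_{\sigma(i)\sigma(j)}=\beta_{ij}$ for all $i,j$. A $k$-labeled graph ($k\ge 0$) is a finite unweighted graph (multiple edges allowed, no loops) in which $k$ distinct nodes are labeled $1,\dots,k$ (with any number of unlabeled nodes). For a $k$-labeled graph $F$ and a map $\phi:\{1,\dots,k\}\to V(G)$, define $$\hom_\phi(F,G)=\sum_{\psi}\ \prod_{u\in V(F)\text{ unlabeled}}\alpha_G(\psi(u))\prod_{uv\in E(F)}\beta_G(\psi(u),\psi(v)),$$ where the sum is over all maps $\psi:V(F)\to V(G)$ extending $\phi$ (i.e.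 sending the node labeled $i$ to $\phi(i)$ for each $i$), and edges are taken with multiplicity. *)

(* Defs.v *)
From HB Require Import structures.
From mathcomp Require Import all_boot all_order all_fingroup all_algebra.
From mathcomp Require Import reals.

Set Implicit Arguments.
Unset Strict Implicit.
Unset Printing Implicit Defensive.

Import Order.TTheory GRing.Theory Num.Theory.
Local Open Scope ring_scope.

Record wgraph (R : realType) := WGraph {
  wnode :> finType;
  alpha : wnode -> R;
  beta : wnode -> wnode -> R;
  alpha_gt0 : forall i, 0 < alpha i;
  beta_sym : forall i j, beta i j = beta j i
}.

Definition twins (R : realType) (G : wgraph R) (i j : G) : Prop :=
  forall l : G, beta i l = beta j l.

Definition twin_free (R : realType) (G : wgraph R) : Prop :=
  forall i j : G, i <> j -> ~ twins i j.

Definition automorphism (R : realType) (G : wgraph R) (s : {perm G}) : Prop :=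
  (forall i : G, alpha (s i) = alpha i) /\
  (forall i j : G, beta (s i) (s j) = beta i j).

(* Edges form a finite type of their own, so that parallel edges are distinct
   elements. The order of the two endpoints of an edge carries no meaning: it
   does not affect [hom_lab], because [beta] is symmetric. *)
Record lgraph (k : nat) := LGraph {
  lnode : finType;
  ledge : finType;
  src : ledge -> lnode;
  tgt : ledge -> lnode;
  loopless : forall e, src e <> tgt e;
  label : 'I_k -> lnode;
  label_inj : injective label
}.

Definition hom_lab (R : realType) (k : nat) (F : lgraph k) (G : wgraph R)
    (phi : 'I_k -> G) : R :=
  \sum_(f : {ffun lnode F -> G} | [forall i, f (label F i) == phi i])
    (\prod_(u : lnode F | u \notin codom (label F)) alpha (f u)) *
    (\prod_(e : ledge F) beta (f (src e)) (f (tgt e))).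

(* Main.v *)
Require Import Defs.
From mathcomp Require Import all_boot all_order all_fingroup all_algebra.
From mathcomp Require Import boolp reals.

(** Call two labelings [phi, psi : L -> G] indistinguishable when every
    L-labeled graph has the same homomorphism number at both.  As functions of
    the labeling, linear combinations of homomorphism numbers form an algebra
    containing the constants (gluing two graphs along their labels multiplies
    them, [quantum_mul]), so, over finitely many labelings, they contain the
    indicator functions of the indistinguishability classes
    ([class_indicator]), as in a finite Stone-Weierstrass theorem.

    Forgetting some labels sums such a function over the images of the
    forgotten nodes, with weights [alpha].  Applied to a class indicator this
    gives [class_weight]: if [phi] and [psi] are indistinguishable, then the
    extensions of [phi] by new labels and those of [psi] put the same total
    weight on every class.  As weights are positive, every extension of [phi]
    has an indistinguishable extension of [psi] ([indist_extend]).

    Now extend [phi] by three copies of the identity of [G], and let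
    [t0, t1, t2 : G -> G] be the three blocks of the matching extension of
    [psi].  Single edges between different labels give
    [beta (tc x) (td y) = beta x y] for [c != d].  Twin-freeness turns this into
    injectivity of each [tc], and then into [t0 = t1] by comparing both with
    [t2]; hence [t0] preserves all edge weights, including loops, which no
    loopless graph sees directly.  The same comparison gives
    [psi i = t0 (phi i)].  Finally, once all nodes of [G] occur as images of
    labels, one further label at [x] has a class consisting of [x] alone over
    [phi] and of [t0 x] alone over [psi], so [class_weight] says that
    [alpha (t0 x) = alpha x]. *)

Set Implicit Arguments.
Unset Strict Implicit.
Unset Printing Implicit Defensive.

Import Order.TTheory GRing.Theory Num.Theory.
Local Open Scope ring_scope.

(** * Labeled graphs over an arbitrary finite set of labels *)

(** The node set is the disjoint union of the labels and the unlabeled nodes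
    [pfree]; gluing and forgetting labels then amount to regrouping sums of
    types, with no quotient to form. *)
Record pgraph (L : finType) := PGraph {
  pfree : finType;
  pedge : finType;
  psrc : pedge -> L + pfree;
  ptgt : pedge -> L + pfree;
  ploopless : forall e, psrc e <> ptgt e
}.

Definition join (A B T : Type) (f : A -> T) (g : B -> T) (v : A + B) : T :=
  match v with inl a => f a | inr b => g b end.

Lemma sum_ffun_sum (R : realType) (A B T : finType)
    (P : pred {ffun A + B -> T}) (F : {ffun A + B -> T} -> R) :
  \sum_(h | P h) F h =
  \sum_(f : {ffun A -> T}) \sum_(g : {ffun B -> T} | P (finfun (join f g)))
     F (finfun (join f g)).
Proof.
rewrite pair_big_dep /=.
apply: (reindex (fun p : {ffun A -> T} * {ffun B -> T} =>
                   finfun (join p.1 p.2))) => /=.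
apply: onW_bij.
exists (fun h : {ffun A + B -> T} =>
          ([ffun a => h (inl a)], [ffun b => h (inr b)])).
- by move=> [f g]; congr pair; apply/ffunP => x; rewrite !ffunE.
- by move=> h; apply/ffunP => -[a|b]; rewrite !ffunE /= ffunE.
Qed.

Lemma sum_ffun_void (R : realType) (T : finType) (F : {ffun void -> T} -> R) f :
  \sum_g F g = F f.
Proof. by apply: big_pred1 => g; apply/esym/eqP/ffunP; case. Qed.

Section Quantum.
Variables (R : realType) (G : wgraph R).

Definition nweight (A : finType) (g : A -> G) : R := \prod_a alpha (g a).

Lemma nweight_gt0 (A : finType) (g : A -> G) : 0 < nweight g.
Proof. by apply: prodr_gt0 => a _; apply: alpha_gt0. Qed.

Lemma nweight_join (A B : finType) (f : A -> G) (g : B -> G) :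
  nweight (finfun (join f g)) = nweight f * nweight g.
Proof.
by rewrite /nweight big_sumType /=; congr (_ * _); apply: eq_bigr => x _;
  rewrite ffunE.
Qed.

Definition phom (L : finType) (F : pgraph L) (phi : L -> G) : R :=
  \sum_(g : {ffun pfree F -> G}) nweight g *
    \prod_e beta (join phi g (psrc e)) (join phi g (ptgt e)).

Lemma phom_lgraph k (F : pgraph 'I_k) :
  exists F' : lgraph k, forall phi : 'I_k -> G, hom_lab F' phi = phom F phi.
Proof.
have inl_inj : injective (@inl 'I_k (pfree F)) by move=> a b [].
exists (LGraph (@ploopless _ F) inl_inj) => phi.
rewrite /hom_lab /= sum_ffun_sum (bigD1 (finfun phi)) //= [X in _ + X]big1.
- rewrite addr0 /phom; apply: eq_big => [g|g _].
  + by apply/forallP => i; rewrite !ffunE /= ffunE.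
  + congr (_ * _).
    * rewrite big_sumType /= big_pred0 ?mul1r; last first.
        by move=> i; rewrite codom_f.
      apply: eq_big => [u|u _]; last by rewrite ffunE.
      by apply/negP => /codomP [].
    * by apply: eq_bigr => e _; congr (beta _ _); rewrite ffunE;
        case: (_ e) => //= i; rewrite ffunE.
- move=> f /eqP nf; apply: big_pred0 => g; apply/negP => /forallP H.
  apply: nf; apply/ffunP => i.
  by move/eqP: (H i); rewrite !ffunE.
Qed.

Lemma phom_all_labeled (L E : finType) (s t : E -> L) :
  (forall e, s e <> t e) ->
  exists F : pgraph L, forall phi : L -> G,
    phom F phi = \prod_e beta (phi (s e)) (phi (t e)).
Proof.
move=> st.
have st' e : inl (s e) <> inl (t e) :> L + void by move=> [] /st.
exists (PGraph st') => phi.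
have g0 : {ffun void -> G} by apply: finfun => -[].
by rewrite /phom /= (sum_ffun_void _ g0) /nweight big_pred0 ?mul1r // => -[].
Qed.

(** Two graphs glued along their labels share no unlabeled node and no edge, so
    the sum over the images of the unlabeled nodes factors. *)
Lemma phom_glue (L : finType) (F1 F2 : pgraph L) :
  exists F : pgraph L, forall phi : L -> G,
    phom F phi = phom F1 phi * phom F2 phi.
Proof.
pose i1 (v : L + pfree F1) : L + (pfree F1 + pfree F2) :=
  join inl (inr \o inl) v.
pose i2 (v : L + pfree F2) : L + (pfree F1 + pfree F2) :=
  join inl (inr \o inr) v.
have i1_inj : injective i1 by move=> [a|a] [b|b] // [->].
have i2_inj : injective i2 by move=> [a|a] [b|b] // [->].
have ll (e : pedge F1 + pedge F2) :
    join (i1 \o @psrc _ F1) (i2 \o @psrc _ F2) e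
    <> join (i1 \o @ptgt _ F1) (i2 \o @ptgt _ F2) e.
  by case: e => e /= => [/i1_inj|/i2_inj]; apply: ploopless.
exists (PGraph ll) => phi; rewrite /phom /= sum_ffun_sum mulr_suml.
apply: eq_bigr => g1 _; rewrite mulr_sumr; apply: eq_bigr => g2 _.
rewrite nweight_join mulrACA big_sumType /=.
by congr (_ * (_ * _)); apply: eq_bigr => e _; congr (beta _ _);
  case: (_ e) => //= u; rewrite ffunE.
Qed.

(** A label that is forgotten becomes an unlabeled node: its image is summed
    over, and its node weight enters the product. *)
Lemma phom_unlabel (L X : finType) (F : pgraph (L + X)%type) :
  exists F' : pgraph L, forall phi : L -> G,
    phom F' phi = \sum_(xi : {ffun X -> G}) nweight xi * phom F (join phi xi).
Proof.
pose a (v : (L + X) + pfree F) : L + (X + pfree F) :=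
  join (join inl (inr \o inl)) (inr \o inr) v.
have a_inj : injective a by move=> [[v|v]|v] [[w|w]|w] // [->].
have ll e : a (@psrc _ F e) <> a (ptgt e) by move/a_inj; apply: ploopless.
exists (PGraph ll) => phi; rewrite /phom /= sum_ffun_sum.
apply: eq_bigr => xi _; rewrite mulr_sumr; apply: eq_bigr => g _.
rewrite nweight_join -mulrA; congr (_ * (_ * _)).
by apply: eq_bigr => e _; congr (beta _ _);
  case: (_ e) => [[]|] //= u; rewrite ffunE.
Qed.

(** * The algebra of homomorphism functions *)

(** The linear span of the functions [phom F], up to pointwise equality (the
    values of quantum graphs, in the usual terminology). *)
Inductive quantum (L : finType) : ((L -> G) -> R) -> Prop :=
| quantum_hom F f : (forall phi, f phi = phom F phi) -> quantum f
| quantum_lin c f g h : quantum f -> quantum g ->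
    (forall phi, h phi = c * f phi + g phi) -> quantum h.

Definition indist (L : finType) (phi psi : L -> G) : Prop :=
  forall F : pgraph L, phom F phi = phom F psi.

Lemma quantum_indist (L : finType) (f : (L -> G) -> R) phi psi :
  quantum f -> indist phi psi -> f phi = f psi.
Proof.
move=> qf eqv; elim: qf => {f} [F f fE|c f g h _ fE _ gE hE].
  by rewrite !fE.
by rewrite !hE fE gE.
Qed.

Lemma quantum1 (L : finType) : quantum (fun _ : L -> G => 1).
Proof.
have st (e : void) : of_void L e <> of_void L e by case: e.
have [F FE] := phom_all_labeled st.
by apply: (@quantum_hom _ F) => phi; rewrite FE big_pred0 // => -[].
Qed.

Lemma quantum_mul (L : finType) (f g : (L -> G) -> R) :
  quantum f -> quantum g -> quantum (fun phi => f phi * g phi).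
Proof.
move=> qf qg; elim: qf => {f} [F f fE|c f1 f2 h _ q1 _ q2 hE]; last first.
  by apply: (quantum_lin (c := c) q1 q2) => phi; rewrite hE mulrDl mulrA.
elim: qg => {g} [F' g gE|c f1 f2 h _ q1 _ q2 hE]; last first.
  by apply: (quantum_lin (c := c) q1 q2) => phi; rewrite hE mulrDr mulrCA.
have [H HE] := phom_glue F F'.
by apply: (@quantum_hom _ H) => phi; rewrite fE gE HE.
Qed.

Lemma quantum_unlabel (L X : finType) (f : (L + X -> G) -> R) :
  quantum f ->
  quantum (fun phi => \sum_(xi : {ffun X -> G}) nweight xi * f (join phi xi)).
Proof.
elim=> {f} [F f fE|c f g h _ qf _ qg hE].
  have [F' F'E] := phom_unlabel F.
  apply: (@quantum_hom _ F') => phi; rewrite F'E.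
  by apply: eq_bigr => xi _; rewrite fE.
apply: (quantum_lin (c := c) qf qg) => phi.
rewrite mulr_sumr -big_split; apply: eq_bigr => xi _ /=.
by rewrite hE mulrDr mulrCA.
Qed.

(** An affine function of one distinguishing homomorphism number. *)
Lemma quantum_separate (L : finType) (phi psi : L -> G) :
  ~ indist phi psi -> exists f, [/\ quantum f, f phi = 1 & f psi = 0].
Proof.
move=> /existsNP [F /eqP neF].
pose d := phom F phi - phom F psi.
have d0 : d != 0 by rewrite subr_eq0.
have qF : quantum (@phom L F) by apply: (@quantum_hom _ F).
have q0 : quantum (fun _ : L -> G => 0).
  by apply: (quantum_lin (c := -1) (quantum1 L) (quantum1 L)) => _;
    rewrite mulr1 addNr.
have qc : quantum (fun _ : L -> G => - (phom F psi / d)).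
  by apply: (quantum_lin (c := - (phom F psi / d)) (quantum1 L) q0) => _;
    rewrite mulr1 addr0.
exists (fun chi => d^-1 * phom F chi + - (phom F psi / d)); split.
- exact: quantum_lin qF qc _.
- by rewrite (mulrC d^-1) -mulrBl divff.
- by rewrite (mulrC d^-1) subrr.
Qed.

(** The product, over the labelings in the family outside the class of [phi],
    of functions separating them from [phi]. *)
Lemma class_indicator (L I : finType) (phi : L -> G) (chi : I -> L -> G) :
  exists2 f, quantum f & forall i, f (chi i) = `[< indist phi (chi i) >]%:R.
Proof.
suff [f [qf f1 f0]] : exists f, [/\ quantum f, f phi = 1 &
    forall i, i \in enum I -> ~ indist phi (chi i) -> f (chi i) = 0].
  exists f => // i; case: asboolP => [e|ne].
    by rewrite -(quantum_indist qf e).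
  by rewrite f0 ?mem_enum.
elim: (enum I) => [|i s [f [qf f1 f0]]].
  by exists (fun=> 1); split=> //; apply: quantum1.
have [e|/quantum_separate [g [qg g1 g0]]] := pselect (indist phi (chi i)).
  by exists f; split=> // j; rewrite inE => /predU1P [->|] //; apply: f0.
exists (fun psi => g psi * f psi); split.
- exact: quantum_mul.
- by rewrite f1 g1 mulr1.
- move=> j; rewrite inE => /predU1P [-> _|js ne]; first by rewrite g0 mul0r.
  by rewrite f0 ?mulr0.
Qed.

(** * Extending indistinguishable labelings *)

(** Forgetting the labels in [X] turns the indicator function of the class of
    [chi] into a function that cannot distinguish [phi] from [psi]; its values
    there are the two sides. *)
Lemma class_weight (L X : finType) (phi psi : L -> G) (chi : L + X -> G) :
  indist phi psi ->
  \sum_(xi : {ffun X -> G} | `[< indist chi (join phi xi) >]) nweight xi =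
  \sum_(xi : {ffun X -> G} | `[< indist chi (join psi xi) >]) nweight xi.
Proof.
move=> eqv.
have [f qf fE] := class_indicator chi
  (fun p : bool * {ffun X -> G} => join (if p.1 then phi else psi) p.2).
have := quantum_indist (quantum_unlabel qf) eqv.
under eq_bigr => xi _ do rewrite (fE (true, xi)) mulr_natr mulrb.
under [in X in _ = X -> _]eq_bigr => xi _
  do rewrite (fE (false, xi)) mulr_natr mulrb.
by rewrite -!big_mkcond.
Qed.

Lemma indist_extend (L X : finType) (phi psi : L -> G) (xi : {ffun X -> G}) :
  indist phi psi ->
  exists eta : {ffun X -> G}, indist (join phi xi) (join psi eta).
Proof.
move=> eqv; apply: contrapT => /forallNP none.
have := class_weight (join phi xi) eqv.
(* The side of [phi] is positive because it contains the term of [xi]. *)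
rewrite [RHS]big_pred0 => [|eta]; last exact/asboolPn/none.
apply/eqP; rewrite gt_eqF // (bigD1 xi) /=; last exact/asboolP.
apply: ltr_wpDr; last exact: nweight_gt0.
by apply: sumr_ge0 => ? _; apply/ltW/nweight_gt0.
Qed.

Lemma indist_beta (L : finType) (phi psi : L -> G) a b :
  indist phi psi -> a <> b -> beta (phi a) (phi b) = beta (psi a) (psi b).
Proof.
move=> eqv ab.
have [F FE] := @phom_all_labeled L unit (fun=> a) (fun=> b) (fun=> ab).
by have := eqv F; rewrite !FE !(big_pred1 tt) //; case.
Qed.

Lemma twin_free_eq (u v : G) :
  twin_free G -> (forall z, beta u z = beta v z) -> u = v.
Proof. by move=> tf uv; apply: contrapT => ne; exact: (tf u v ne uv). Qed.

(** A node is determined by its edge weights to the images of the labels, which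
    are all of [G] for [phi] and for [psi].  So the class of the extension of
    [phi] by one more label placed at [y] contains no other extension of [phi],
    and only the one placed at [s y] among those of [psi]. *)
Lemma indist_alpha (L : finType) (phi psi : L -> G) (l : G -> L) (s : G -> G) y :
  twin_free G -> indist phi psi ->
  (forall x, phi (l x) = x) -> (forall x, psi (l x) = s x) ->
  injective s -> (forall x z, beta (s x) (s z) = beta x z) ->
  alpha (s y) = alpha y.
Proof.
move=> tf eqv phil psil s_inj s_beta.
pose pt (x : G) : {ffun unit -> G} := [ffun=> x].
have ptE (xi : {ffun unit -> G}) : xi = pt (xi tt).
  by apply/ffunP => -[]; rewrite ffunE.
have weight_pt x : nweight (pt x) = alpha x.
  by rewrite /nweight (big_pred1 tt) ?ffunE // => -[].
have dist (chi : L -> G) xi z : indist (join phi (pt y)) (join chi xi) ->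
    beta y z = beta (xi tt) (chi (l z)).
  move=> e; have := indist_beta (a := inr tt) (b := inl (l z)) e.
  by rewrite /= ffunE phil; apply.
have over_phi (xi : {ffun unit -> G}) :
    indist (join phi (pt y)) (join phi xi) -> xi = pt y.
  move=> e; rewrite [xi]ptE; congr pt; apply: twin_free_eq tf _ => z.
  by rewrite (dist _ _ _ e) phil.
have over_psi (xi : {ffun unit -> G}) :
    indist (join phi (pt y)) (join psi xi) -> xi = pt (s y).
  move=> e; rewrite [xi]ptE; congr pt; apply: twin_free_eq tf _ => z.
  by rewrite -(f_invF s_inj z) s_beta (dist _ _ _ e) psil.
(* The class is met over [psi] as well, since extensions can be matched. *)
have := class_weight (join phi (pt y)) eqv.
rewrite (big_pred1 (pt y)) => [|xi]; last first.
  by apply/asboolP/eqP => [|->]; first exact: over_phi.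
rewrite (big_pred1 (pt (s y))) => [|xi]; last first.
  apply/asboolP/eqP => [|->]; first exact: over_psi.
  by have [eta e] := indist_extend (pt y) eqv; rewrite -(over_psi _ e).
by rewrite !weight_pt.
Qed.

End Quantum.

(** * The automorphism *)

Theorem lemma2p4 (R : realType) (G : wgraph R) (k : nat) (phi psi : 'I_k -> G) :
  twin_free G ->
  (forall F : lgraph k, hom_lab F phi = hom_lab F psi) ->
  exists s : {perm G}, automorphism s /\ forall i : 'I_k, psi i = s (phi i).
Proof.
move=> tf homE.
have eqv : indist phi psi.
  by move=> F; have [F' F'E] := phom_lgraph G F; rewrite -!F'E.
have [eta e] := indist_extend [ffun p : 'I_3 * G => p.2] eqv.
(* Two different copies are needed to see the loop at a node as an edge, and
   a third one to show that those two are matched in the same way. *)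
pose t c x := eta (c, x).
have t_beta c d x y : c <> d -> beta (t c x) (t d y) = beta x y.
  move=> cd; have /= := indist_beta (a := inr (c, x)) (b := inr (d, y)) e.
  by rewrite !ffunE => <- // -[].
have psi_beta i c y : beta (psi i) (t c y) = beta (phi i) y.
  have /= := indist_beta (a := inl i) (b := inr (c, y)) e.
  by rewrite !ffunE => <-.
pose c0 : 'I_3 := inord 0; pose c1 : 'I_3 := inord 1; pose c2 : 'I_3 := inord 2.
have c01 : c0 <> c1 by move/(congr1 val); rewrite /= !inordK.
have c02 : c0 <> c2 by move/(congr1 val); rewrite /= !inordK.
have c12 : c1 <> c2 by move/(congr1 val); rewrite /= !inordK.
have t_inj c d : c <> d -> injective (t c).
  by move=> cd x x' xx'; apply: twin_free_eq tf _ => z; rewrite -(t_beta c d) // xx' t_beta.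
have t0_inj : injective (t c0) by apply: t_inj c01.
have t2_inj : injective (t c2) by apply: (t_inj _ c0) => /esym.
have via2 u v : (forall y, beta u (t c2 y) = beta v (t c2 y)) -> u = v.
  by move=> uv; apply: twin_free_eq tf _ => z; rewrite -(f_invF t2_inj z).
have t01 x : t c0 x = t c1 x by apply: via2 => y; rewrite !t_beta.
have t0_beta x y : beta (t c0 x) (t c0 y) = beta x y.
  by rewrite [t c0 y]t01 t_beta.
exists (perm t0_inj); split; last first.
  by move=> i; rewrite permE; apply: via2 => y; rewrite psi_beta t_beta.
split=> [x|x y]; last by rewrite !permE.
rewrite permE; apply: (indist_alpha (l := fun x => inr (c0, x)) x tf e) => //.
by move=> z /=; rewrite ffunE.
Qed.
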